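(* Let $G$ be a finite group with center $Z(G)$ such that $G/Z(G)\cong Sz(2)$, the Suzuki group of order $20$, and let $\Gamma_G$ be the non-commuting graph of $G$. Then: (a) $E(\Gamma_G)<LE^+(\Gamma_G)<LE(\Gamma_G)$. (b) $\Gamma_G$ is neither hypoenergetic nor hyperenergetic. (c) $\Gamma_{Sz(2)}$ is not Q-hyperenergetic but is L-hyperenergetic. If $G\not\cong Sz(2)$ then $\Gamma_G$ is both Q-hyperenergetic and L-hyperenergetic.
   Context: $Sz(2)$ is the group of order $20$ with presentation $\langle a,b : a^5=b^4=1,\ b^{-1}ab=a^2\rangle$. For a finite non-abelian group $G$ with center $Z(G)$, the non-commuting graph $\Gamma_G$ is the simple undirected graph with vertex set $G\setminus Z(G)$ in which $x,y$ are adjacent iff $xy\ne yx$. For a finite simple graph $\mathcal G$ with vertex set $v(\mathcal G)$, edge set $e(\mathcal G)$, adjacency matrix $A(\mathcal G)$ and diagonal degree matrix $D(\mathcal G)$, put $L(\mathcal G)=D(\mathcal G)-A(\mathcal G)$ (Laplacian) and $Q(\mathcal G)=D(\mathcal G)+A(\mathcal G)$ (signless Laplacian). With sums over eigenvalues counted with multiplicity, define $E(\mathcal G)=\sum_{\lambda}|\lambda|$ ($\lambda$ eigenvalues of $A(\mathcal G)$), $LE(\mathcal G)=\sum_{\beta}\left|\beta-\frac{2|e(\mathcal G)|}{|v(\mathcal G)|}\right|$ ($\beta$ eigenvalues of $L(\mathcal G)$), $LE^+(\mathcal G)=\sum_{\gamma}\left|\gamma-\frac{2|e(\mathcal G)|}{|v(\mathcal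 G)|}\right|$ ($\gamma$ eigenvalues of $Q(\mathcal G)$). With $K_n$ the complete graph on $n$ vertices, $\mathcal G$ is called hyperenergetic if $E(\mathcal G)>E(K_{|v(\mathcal G)|})$, hypoenergetic if $E(\mathcal G)<|v(\mathcal G)|$, L-hyperenergetic if $LE(\mathcal G)>LE(K_{|v(\mathcal G)|})$, and Q-hyperenergetic if $LE^+(\mathcal G)>LE^+(K_{|v(\mathcal G)|})$. *)

(* Defs.v *)
From mathcomp Require Import all_boot all_order all_algebra.
From mathcomp Require Import all_fingroup all_solvable all_field.

Set Implicit Arguments.
Unset Strict Implicit.
Unset Printing Implicit Defensive.

Import GroupScope Order.TTheory GRing.Theory Num.Theory.
Local Open Scope ring_scope.

Record sgraph := SGraph {
  vertex : finType;
  edge : rel vertex;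
  edge_sym : symmetric edge;
  edge_irrefl : irreflexive edge }.

Definition order_graph (g : sgraph) : nat := #|vertex g|.

Definition edge_set (g : sgraph) : {set {set vertex g}} :=
  [set [set p.1; p.2] | p : vertex g * vertex g & edge p.1 p.2].

Definition degree (g : sgraph) (x : vertex g) : nat := #|[set y | edge x y]|.

(* The matrices of a graph are indexed by the ranks of its vertices in the
   canonical enumeration of its vertex type. *)
Definition adjacency_mx (g : sgraph) : 'M[algC]_(order_graph g) :=
  \matrix_(i, j) (edge (enum_val i) (enum_val j) : bool)%:R.

Definition degree_mx (g : sgraph) : 'M[algC]_(order_graph g) :=
  diag_mx (\row_i (degree (enum_val i))%:R).

Definition laplacian_mx (g : sgraph) := degree_mx g - adjacency_mx g.

Definition signless_laplacian_mx (g : sgraph) := degree_mx g + adjacency_mx g.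

(* The eigenvalues of A, each repeated according to its multiplicity as a root
   of the characteristic polynomial; the order of the list is immaterial. *)
Definition spectrum (n : nat) (A : 'M[algC]_n) : seq algC :=
  sval (closed_field_poly_normal (char_poly A)).

Lemma spectrumP (n : nat) (A : 'M[algC]_n) :
  char_poly A = \prod_(z <- spectrum A) ('X - z%:P).
Proof.
rewrite /spectrum; case: (closed_field_poly_normal _) => /= r {1}->.
by rewrite (monicP (char_poly_monic A)) scale1r.
Qed.

Definition mean_degree (g : sgraph) : algC :=
  (2 * #|edge_set g|)%N%:R / (order_graph g)%:R.

(* The three energies are sums of moduli of algebraic numbers, hence real and
   nonnegative, so that the partial order of algC is total on their values. *)
Definition energy (g : sgraph) : algC :=
  \sum_(z <- spectrum (adjacency_mx g)) `|z|.

Definition laplacian_energy (g : sgraph) : algC :=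
  \sum_(z <- spectrum (laplacian_mx g)) `|z - mean_degree g|.

Definition signless_laplacian_energy (g : sgraph) : algC :=
  \sum_(z <- spectrum (signless_laplacian_mx g)) `|z - mean_degree g|.

Section Complete.
Variable n : nat.
Let complete_edge : rel 'I_n := fun i j => i != j.
Fact complete_edge_sym : symmetric complete_edge.
Proof. by move=> i j; rewrite /complete_edge eq_sym. Qed.
Fact complete_edge_irrefl : irreflexive complete_edge.
Proof. by move=> i; rewrite /complete_edge eqxx. Qed.
Definition complete_graph := SGraph complete_edge_sym complete_edge_irrefl.
End Complete.

Definition hyperenergetic (g : sgraph) : bool :=
  energy (complete_graph (order_graph g)) < energy g.

Definition hypoenergetic (g : sgraph) : bool :=
  energy g < (order_graph g)%:R.

Definition L_hyperenergetic (g : sgraph) : bool :=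
  laplacian_energy (complete_graph (order_graph g)) < laplacian_energy g.

Definition Q_hyperenergetic (g : sgraph) : bool :=
  signless_laplacian_energy (complete_graph (order_graph g))
    < signless_laplacian_energy g.

Section NonCommuting.
Variables (gT : finGroupType) (G : {group gT}).
Let ncvertex := {x : gT | x \in G :\: 'Z(G)}.
Let ncedge : rel ncvertex := fun x y => (val x * val y)%g != (val y * val x)%g.
Fact ncedge_sym : symmetric ncedge.
Proof. by move=> x y; rewrite /ncedge eq_sym. Qed.
Fact ncedge_irrefl : irreflexive ncedge.
Proof. by move=> x; rewrite /ncedge eqxx. Qed.
Definition noncommuting_graph := SGraph ncedge_sym ncedge_irrefl.
End NonCommuting.

(* Recall that x ^ y is y^-1 * x * y, and that G \isog Grp (x : y : ...)
   means that G is isomorphic to the largest finite quotient of the presented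
   group. The group presented here is finite, so this determines Sz(2) up to
   isomorphism. *)
Definition is_Sz2 (gT : finGroupType) (G : {group gT}) : Prop :=
  G \isog Grp (a : b : (a ^+ 5, b ^+ 4, a ^ b = a ^+ 2)).

(* The presentation has a model, and of the expected order: the semidirect
   product of the cyclic group of order 5 by that of order 4, acting by
   squaring. *)
Lemma is_Sz2_model :
  is_Sz2 [set: Extremal.gtype 5 4 2]%G /\ #|[set: Extremal.gtype 5 4 2]| = 20.
Proof.
split; last by rewrite Extremal.card.
apply: Extremal.Grp => //.
have inj2 : injective (fun x : 'Z_5 => (x + x)%R).
  have /forallP H : [forall x : 'Z_5, forall y : 'Z_5,
     (x + x == y + y)%R ==> (x == y)].
    by apply/forallP => -[[|[|[|[|[|?]]]]] ?] //;
      apply/forallP => -[[|[|[|[|[|?]]]]] ?].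
  by move=> x y /eqP E; apply/eqP; move: (H x) => /forallP/(_ y)/implyP; apply.
exists (perm inj2); split; last by rewrite permE.
  rewrite inE; apply/andP; split.
    by apply/subsetP => x _; rewrite -Zp_cycle inE.
  by apply/morphicP => x y _ _; rewrite !permE addrACA.
rewrite order_dvdn; apply/eqP/permP => x.
rewrite !expgS expg0 !permM !permE.
by case: x => -[|[|[|[|[|?]]]]] ? //; apply/val_inj.
Qed.

(* Main.v *)
(* Sz(2) is a Frobenius group with cyclic kernel of order 5 and five cyclic
   complements of order 4, and these six subgroups contain the centralizers of
   their nontrivial elements. Two noncentral elements of G therefore commute iff
   their images in G / Z(G) lie in the same of these subgroups: with z = |Z(G)|,
   the non-commuting graph is complete multipartite with one part of size 4z and
   five of size 3z. For a D + c A on such a graph, the characteristic polynomial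
   reduces to that of the quotient matrix on the 6 parts and then to that of a
   2 x 2 matrix on the two kinds of parts. This gives
     E   = (12 + 8 sqrt 6) z,
     LE  = 30 z + 120/19 z^2,
     LE+ = (177/19 + sqrt 409) z + 120/19 z^2,
   to be compared with 2 (19 z - 1), the common value of the three energies of
   the complete graph. *)
Require Import Defs.
From mathcomp Require Import all_boot all_order all_algebra.
From mathcomp Require Import all_fingroup all_solvable all_field.
From mathcomp Require Import ring lra zify.

Set Implicit Arguments.
Unset Strict Implicit.
Unset Printing Implicit Defensive.

Import GroupScope Order.TTheory GRing.Theory Num.Theory.
Local Open Scope ring_scope.

(** * Characteristic polynomials of block-constant matrices *)

Lemma char_poly_intertwine (R : comNzRingType) n m (D : 'M[R]_n)
    (P : 'M[R]_(n, m)) (C : 'M[R]_(m, n)) (E : 'M[R]_m) :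
  D *m P = P *m E ->
  char_poly (D + P *m C) * char_poly E = char_poly D * char_poly (E + C *m P).
Proof.
(* Both sides equal det W * det XE for W = [[XD, p], [c, 1]]: clear the block c
   of W, resp. its block p, by a multiplication on the right. *)
move=> DP; rewrite /char_poly /char_poly_mx.
set XD := 'X%:M - map_mx polyC D; set XE := 'X%:M - map_mx polyC E.
pose p := map_mx polyC P; pose c := map_mx polyC C.
have XDp : XD *m p = p *m XE.
  by rewrite mulmxBl mulmxBr mul_scalar_mx mul_mx_scalar -!map_mxM DP.
have WU : block_mx XD p c 1%:M *m block_mx 1%:M 0 (- c) 1%:M
          = block_mx (XD - p *m c) p 0 1%:M.
  by rewrite mulmx_block !mulmx1 !mulmx0 !mul1mx !add0r mulmxN subrr.
have WV : block_mx XD p c 1%:M *m block_mx 1%:M (- p) 0 XE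
          = block_mx XD 0 c (XE - c *m p).
  rewrite mulmx_block !mulmx1 !mulmx0 !mul1mx !mulmxN XDp !addr0 addNr.
  by rewrite [- _ + _]addrC.
have dW : \det (block_mx XD p c 1%:M) = \det (XD - p *m c).
  have := congr1 determinant WU.
  by rewrite det_mulmx det_lblock det_ublock !det1 !mulr1.
have := congr1 determinant WV.
rewrite det_mulmx det_ublock det_lblock det1 mul1r dW.
by rewrite !map_mxD !map_mxM !opprD !addrA.
Qed.

Lemma char_poly_diag (R : comNzRingType) n (d : 'rV[R]_n) :
  char_poly (diag_mx d) = \prod_i ('X - (d 0 i)%:P).
Proof.
rewrite char_poly_trig ?diag_mx_is_trig //.
by apply: eq_bigr => i _; rewrite mxE eqxx mulr1n.
Qed.

(** The matrix is [D + P *m CC] with [P] the incidence matrix of the partition into fibres of [p].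
    As [D] is constant on fibres, it intertwines with [E] through [P]. The factor [char_poly E] is
    monic, so it cancels, and it takes one factor ['X - (d k)%:P] from each fibre; nonemptiness of
    the fibres makes [.-1] exact. *)
Lemma char_poly_equitable (R : idomainType) n m (p : 'I_n -> 'I_m)
    (d : 'I_m -> R) (C : 'I_m -> 'I_n -> R) :
  (forall k, 0 < #|[set i | p i == k]|)%N ->
  char_poly (\matrix_(i, j) (d (p i) *+ (i == j) + C (p i) j))
  = \prod_k ('X - (d k)%:P) ^+ #|[set i | p i == k]|.-1
    * char_poly (\matrix_(k, l) (d k *+ (k == l) + \sum_(j | p j == l) C k j)).
Proof.
move=> psurj.
pose D := diag_mx (\row_i d (p i)); pose E := diag_mx (\row_k d k).
pose P : 'M[R]_(n, m) := \matrix_(i, k) (p i == k)%:R.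
pose CC : 'M[R]_(m, n) := \matrix_(k, j) C k j.
have DP : D *m P = P *m E.
  apply/matrixP => i k; rewrite mul_diag_mx mul_mx_diag !mxE.
  by case: eqP => [->|_]; rewrite ?mulr1 ?mul1r ?mulr0 ?mul0r.
have -> : \matrix_(i, j) (d (p i) *+ (i == j) + C (p i) j) = D + P *m CC.
  apply/matrixP => i j; rewrite !mxE; congr (_ + _).
  rewrite (bigD1 (p i)) //= !mxE eqxx mul1r big1 ?addr0 // => k.
  by rewrite !mxE eq_sym => /negPf->; rewrite mul0r.
have -> : \matrix_(k, l) (d k *+ (k == l) + \sum_(j | p j == l) C k j)
          = E + CC *m P.
  apply/matrixP => k l; rewrite !mxE; congr (_ + _).
  rewrite big_mkcond; apply: eq_bigr => j _; rewrite !mxE.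
  by case: eqP; rewrite ?mulr1 ?mulr0.
have nzE : char_poly E != 0 by rewrite monic_neq0 ?char_poly_monic.
apply: (mulIf nzE); rewrite (char_poly_intertwine _ DP) mulrAC; congr (_ * _).
rewrite !char_poly_diag (partition_big p xpredT) //= -big_split /=.
apply: eq_bigr => k _; rewrite [in RHS]mxE -exprSr prednK // -prodr_const.
by apply: eq_big => [i|i /eqP <-]; rewrite ?inE // mxE.
Qed.

Lemma det_mx2 (R : comNzRingType) (A : 'M[R]_2) :
  \det A = A 0 0 * A 1 1 - A 0 1 * A 1 0.
Proof.
rewrite (expand_det_row _ 0) !big_ord_recl big_ord0 /cofactor !det_mx11 !mxE.
have -> : lift 0 0 = 1 :> 'I_2 by apply/val_inj.
have -> : lift 1 0 = 0 :> 'I_2 by apply/val_inj.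
by rewrite addr0 expr0 mul1r expr1 mulN1r mulrN.
Qed.

Lemma char_poly_mx2 (R : comNzRingType) (A : 'M[R]_2) :
  char_poly A = 'X^2 - (\tr A)%:P * 'X + (\det A)%:P.
Proof.
rewrite /char_poly /char_poly_mx !det_mx2 /mxtrace !big_ord_recl big_ord0 addr0.
have -> : lift 0 0 = 1 :> 'I_2 by apply/val_inj.
rewrite !mxE /= ?(mulr1n, mulr0n, sub0r) polyCB polyCD !polyCM.
ring.
Qed.

(** * Complete multipartite graphs *)

(** The map from ordered pairs to unordered ones has fibres of size exactly two over the edges,
    since there are no loops. *)
Lemma card_ordered_edges (g : sgraph) :
  #|[set p : vertex g * vertex g | edge p.1 p.2]| = (2 * #|edge_set g|)%N.
Proof.
pose f (p : vertex g * vertex g) := [set p.1; p.2].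
rewrite mulnC -sum_nat_const -sum1_card.
rewrite (partition_big f (mem (edge_set g))) /=; last first.
  by move=> p; rewrite inE => e; apply: imset_f; rewrite inE.
apply: eq_bigr => e /imsetP[[x y]]; rewrite inE /= => exy ->{e}.
have nxy : x != y by apply: contraTneq exy => ->; rewrite edge_irrefl.
rewrite sum1dep_card.
transitivity #|[set (x, y); (y, x)]|; last first.
  by rewrite cards2 xpair_eqE negb_and nxy.
apply: eq_card => -[u v]; rewrite !inE !xpair_eqE /f /=.
apply/andP/orP => [[euv /eqP E]|].
  have nuv : u != v by apply: contraTneq euv => ->; rewrite edge_irrefl.
  have : u \in [set x; y] by rewrite -E !inE eqxx.
  have : v \in [set x; y] by rewrite -E !inE eqxx orbT.
  rewrite !inE => /orP[]/eqP Ev /orP[]/eqP Eu; move: nuv; subst u v;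
    by rewrite ?eqxx // => _; auto.
by case=> /andP[/eqP-> /eqP->]; rewrite ?exy ?(edge_sym y) ?exy // setUC eqxx.
Qed.

Lemma sum_degree (g : sgraph) :
  (\sum_(x : vertex g) degree x = 2 * #|edge_set g|)%N.
Proof.
rewrite -card_ordered_edges -sum1dep_card.
rewrite -(pair_big_dep xpredT (fun x y => edge x y) (fun _ _ => 1%N)) /=.
by apply: eq_bigr => x _; rewrite sum1dep_card.
Qed.

Lemma card_rank_fiber (g : sgraph) m (p : vertex g -> 'I_m) k :
  #|[set i : 'I_(order_graph g) | p (enum_val i) == k]|
  = #|[set x | p x == k]|.
Proof.
rewrite -(card_imset _ (@enum_val_inj _ (vertex g))).
apply: eq_card => x; rewrite inE; apply/imsetP/idP => [[i]|px].
  by rewrite inE => pi ->.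
by exists (enum_rank x); rewrite ?inE enum_rankK.
Qed.

(** These are the complete multipartite graphs, with the fibres of [p] as parts. *)
Definition multipartite (g : sgraph) m (p : vertex g -> 'I_m) :=
  forall x y : vertex g, edge x y = (p x != p y).

Lemma degree_multipartite (g : sgraph) m (p : vertex g -> 'I_m) x :
  multipartite p ->
  degree x = (order_graph g - #|[set y | p y == p x]|)%N.
Proof.
move=> mp; rewrite /degree /order_graph -cardsT -cardsDS ?subsetT //.
by apply: eq_card => y; rewrite !inE mp eq_sym andbT.
Qed.

(** Treating [a] and [c] as parameters covers the adjacency, Laplacian and signless Laplacian
    matrices at once. The quotient matrix is written as a diagonal plus a matrix with equal rows, so
    that [char_poly_equitable] applies to it again whenever parts share a size. *)
Lemma char_poly_multipartite (g : sgraph) m (p : vertex g -> 'I_m)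
    (w : 'I_m -> nat) (a c : algC) :
  multipartite p -> (forall k, #|[set x | p x == k]| = w k) ->
  (forall k, 0 < w k)%N ->
  let d k := a * (order_graph g - w k)%:R in
  char_poly (a *: degree_mx g + c *: adjacency_mx g)
  = \prod_k ('X - (d k)%:P) ^+ (w k).-1
    * char_poly (\matrix_(k, l) ((d k - c * (w k)%:R) *+ (k == l)
                                + c * (w l)%:R)).
Proof.
move=> mp wE w0 d.
pose C (k : 'I_m) (j : 'I_(order_graph g)) := c * (k != p (enum_val j))%:R.
have -> : a *: degree_mx g + c *: adjacency_mx g =
   \matrix_(i, j) (d ((p \o enum_val) i) *+ (i == j) + C ((p \o enum_val) i) j).
  apply/matrixP => i j; rewrite !mxE mp (degree_multipartite _ mp) wE.
  by rewrite /C /d !mulrnAr.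
rewrite (@char_poly_equitable _ _ _ (p \o enum_val) d C) => [|k]; last first.
  by rewrite card_rank_fiber wE.
congr (_ * _).
  by apply: eq_bigr => k _; rewrite card_rank_fiber wE.
congr char_poly; apply/matrixP => k l; rewrite !mxE.
rewrite (eq_bigr (fun=> c * (k != l)%:R)) => [|j /eqP <- //].
rewrite sumr_const -sum1_card sum1dep_card card_rank_fiber wE -mulr_natr.
case: eqP => [->|_]; rewrite ?mulr1n ?mulr0n; ring.
Qed.

Lemma perm_spectrum n (A : 'M[algC]_n) s :
  char_poly A = \prod_(z <- s) ('X - z%:P) -> perm_eq (spectrum A) s.
Proof. by rewrite spectrumP => /prod_XsubC_eq. Qed.

Lemma complete_multipartite n : @multipartite (complete_graph n) n id.
Proof. by []. Qed.

(** The parts are singletons, so the first reduction changes nothing but the form of the matrix; a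
    second one puts all the parts into a single class and leaves a 1 x 1 matrix. *)
Lemma spectrum_complete n (a c : algC) :
  perm_eq (spectrum (a *: degree_mx (complete_graph n.+1)
                     + c *: adjacency_mx (complete_graph n.+1)))
    ((a + c) * n%:R :: nseq n (a * n%:R - c)).
Proof.
set g := complete_graph _; apply: perm_spectrum.
have og : order_graph g = n.+1 by rewrite /order_graph card_ord.
have w1 k : #|[set x : vertex g | id x == k]| = 1%N.
  by rewrite -(cards1 k); apply: eq_card => i; rewrite !inE.
rewrite (char_poly_multipartite a c (@complete_multipartite _) w1) //=.
rewrite og subn1 /= big1 ?mul1r //.
have wE (k : 'I_1) : #|[set i : 'I_n.+1 | 0 == k]| = n.+1.
  by rewrite -[RHS]card_ord; apply: eq_card => i; rewrite inE (ord1 k).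
rewrite (@char_poly_equitable _ _ 1 (fun=> 0) (fun=> a * n%:R - c * 1)
  (fun _ _ => c * 1)) => [|k]; last by rewrite wE.
rewrite big_ord_recl big_ord0 mulr1 wE.
rewrite big_cons big_nseq iter_mulr_1 /= mulrC !mulr1.
congr (_ * _).
rewrite /char_poly det_mx11 !mxE eqxx !mulr1n; congr ('X - _%:P).
rewrite (eq_bigl xpredT) ?sumr_const ?card_ord //.
rewrite -[c *+ _]mulr_natr -natr1; ring.
Qed.

(** With [z] the order of the center, part 0 comes from the kernel of order 5 and has size 5z - z;
    the others come from the complements of order 4 and have size 4z - z. *)
Definition Sz2_part_size (z : nat) (k : 'I_6) : nat :=
  if k == 0 then (4 * z)%N else (3 * z)%N.

Definition Sz2_multipartite (g : sgraph) (z : nat) (p : vertex g -> 'I_6) :=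
  multipartite p /\ forall k, #|[set x | p x == k]| = Sz2_part_size z k.

Lemma order_Sz2_multipartite (g : sgraph) z (p : vertex g -> 'I_6) :
  Sz2_multipartite z p -> order_graph g = (19 * z)%N.
Proof.
case=> _ wE; rewrite /order_graph -sum1_card (partition_big p xpredT) //=.
under eq_bigr => k _ do rewrite sum1dep_card wE /Sz2_part_size.
by rewrite (bigD1 0) //= (eq_bigr (fun=> 3 * z)%N) => [|k /negPf-> //];
  rewrite sum_nat_const cardC1 card_ord; lia.
Qed.

(** The degree sum is 4z * 15z + 5 * 3z * 16z = 300 z^2, over 19z vertices. *)
Lemma mean_degree_Sz2_multipartite (g : sgraph) z (p : vertex g -> 'I_6) :
  (0 < z)%N -> Sz2_multipartite z p -> mean_degree g = 300%:R * z%:R / 19%:R.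
Proof.
move=> z0 pS; have og := order_Sz2_multipartite pS; have [mp wE] := pS.
have -> : mean_degree g = (300 * z ^ 2)%N%:R / (19 * z)%N%:R.
  rewrite /mean_degree og -sum_degree; congr (_%:R / _).
  rewrite (partition_big p xpredT) //=.
  rewrite (eq_bigr (fun k =>
      Sz2_part_size z k * (19 * z - Sz2_part_size z k))%N).
    rewrite (bigD1 0) //=.
    rewrite (eq_bigr (fun=> 3 * z * (16 * z)))%N => [|k /negPf k0].
      by rewrite /Sz2_part_size eqxx sum_nat_const cardC1 card_ord; nia.
    by rewrite /Sz2_part_size k0; congr (_ * _)%N; lia.
  move=> k _; rewrite -{1}wE -sum1dep_card big_distrl /=.
  apply: eq_bigr => x /eqP px.
  by rewrite (degree_multipartite _ mp) og px wE mul1n.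
have nz : z%:R != 0 :> algC by rewrite pnatr_eq0 -lt0n.
by rewrite !natrM; field.
Qed.

(** The last two blocks come from the reduction to six parts, the fourfold value from merging the
    five equal parts, and [r1], [r2] from the remaining 2 x 2 matrix. *)
Definition Sz2_spectrum (R : pzRingType) (z : nat) (a c r1 r2 : R) : seq R :=
  [:: r1; r2] ++ nseq 4 ((16 * a - 3 * c) * z%:R)
  ++ nseq (4 * z).-1 (15 * a * z%:R) ++ nseq (5 * (3 * z).-1) (16 * a * z%:R).

(** The two hypotheses on [r1] and [r2] prescribe the trace and determinant of the 2 x 2 quotient,
    whose rows are 15az, 15cz and 4cz, (16a + 12c)z. *)
Lemma spectrum_Sz2_multipartite (g : sgraph) z (p : vertex g -> 'I_6)
    (a c r1 r2 : algC) :
  (0 < z)%N -> Sz2_multipartite z p ->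
  r1 + r2 = (31 * a + 12 * c) * z%:R ->
  r1 * r2 = (240 * a ^+ 2 + 180 * a * c - 60 * c ^+ 2) * z%:R ^+ 2 ->
  perm_eq (spectrum (a *: degree_mx g + c *: adjacency_mx g))
    (Sz2_spectrum z a c r1 r2).
Proof.
move=> z0 pS r_sum r_prod; have og := order_Sz2_multipartite pS.
have [mp wE] := pS; apply: perm_spectrum.
rewrite (char_poly_multipartite a c mp wE) => [|k]; last first.
  by rewrite /Sz2_part_size; case: ifP; lia.
(* The second partition groups the six parts by size: one large part, five small ones. *)
pose t (k : 'I_6) : 'I_2 := if k == 0 then 0 else 1.
pose v (k : 'I_2) := if k == 0 then (4 * z)%N else (3 * z)%N.
have vt k : Sz2_part_size z k = v (t k).
  by rewrite /Sz2_part_size /v /t; case: (k == 0).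
pose d l := a * (19 * z - v l)%:R - c * (v l)%:R.
have t0 : #|[set k | t k == 0]| = 1%N.
  apply/eqP/cards1P; exists 0; apply/setP => k.
  by rewrite !inE /t; case: (k == 0).
have t1 : #|[set k | t k == 1]| = 5%N.
  transitivity #|predC1 (0 : 'I_6)|; last by rewrite cardC1 card_ord.
  by apply: eq_card => k; rewrite !inE /t; case: (k == 0).
rewrite [X in char_poly X](_ : _ = \matrix_(k, l) (d (t k) *+ (k == l)
  + (fun _ j => c * (v (t j))%:R) (t k) l)); last first.
  by apply/matrixP => k l; rewrite !mxE /d !vt og.
rewrite (@char_poly_equitable _ _ _ t d (fun _ j => c * (v (t j))%:R));
  last first.
  by move=> k; have [->|->] : k = 0 \/ k = 1; rewrite ?t0 ?t1 //;
    case: k => [[|[|]]] // ?; [left|right]; apply/val_inj.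
rewrite char_poly_mx2.
set N := \matrix_(k, l) (d k *+ _ + _).
have lift01 : lift 0 0 = 1 :> 'I_2 by apply/val_inj.
have sub4 : (19 * z - 4 * z = 15 * z)%N by lia.
have sub3 : (19 * z - 3 * z = 16 * z)%N by lia.
have NE k l : N k l = d k *+ (k == l) + (c * (v l)%:R) *+ #|[set i | t i == l]|.
  rewrite mxE; congr (_ + _).
  rewrite (eq_bigr (fun=> c * (v l)%:R)) => [|j /eqP <- //].
  by rewrite sumr_const -sum1_card sum1dep_card.
have d0 : d 0 = (15 * a - 4 * c) * z%:R.
  by rewrite /d /v /= sub4 !natrM; ring.
have d1 : d 1 = (16 * a - 3 * c) * z%:R.
  by rewrite /d /v /= sub3 !natrM; ring.
have -> : \tr N = r1 + r2.
  rewrite r_sum /mxtrace !big_ord_recl big_ord0 lift01 !NE t0 t1 d0 d1 /v /=.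
  by rewrite !natrM; ring.
have -> : \det N = r1 * r2.
  by rewrite r_prod det_mx2 !NE t0 t1 d0 d1 /v /= !natrM; ring.
rewrite mulrA /Sz2_spectrum !big_cat !big_nseq !iter_mulr_1 big_cons big_seq1.
rewrite mulrC [RHS]/=.
have -> : ('X - r1%:P) * ('X - r2%:P) = 'X^2 - (r1 + r2)%:P * 'X + (r1 * r2)%:P.
  by rewrite polyCD polyCM; ring.
congr (_ * _).
have -> : \prod_k ('X - (d k)%:P) ^+ #|[set i | t i == k]|.-1
          = ('X - ((16 * a - 3 * c) * z%:R)%:P) ^+ 4.
  by rewrite !big_ord_recl big_ord0 lift01 t0 t1 d1 expr0 mul1r mulr1.
rewrite mulrC; congr (_ * _).
rewrite (bigD1 0) //= og /Sz2_part_size /= sub4.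
have -> : a * (15 * z)%:R = 15 * a * z%:R by rewrite natrM; ring.
congr (_ * _).
rewrite (eq_bigr (fun=> ('X - (16 * a * z%:R)%:P) ^+ (3 * z).-1)).
  by rewrite prodr_const cardC1 card_ord -exprM mulnC.
move=> k /negPf->; rewrite sub3; congr (('X - _%:P) ^+ _).
by rewrite natrM; ring.
Qed.

(** * Energies *)

Lemma adjacency_mxE (g : sgraph) :
  adjacency_mx g = 0 *: degree_mx g + 1 *: adjacency_mx g.
Proof. by rewrite scale0r scale1r add0r. Qed.

Lemma laplacian_mxE (g : sgraph) :
  laplacian_mx g = 1 *: degree_mx g + (-1) *: adjacency_mx g.
Proof. by rewrite scale1r scaleN1r. Qed.

Lemma signless_laplacian_mxE (g : sgraph) :
  signless_laplacian_mx g = 1 *: degree_mx g + 1 *: adjacency_mx g.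
Proof. by rewrite !scale1r. Qed.

Lemma mean_degree_complete n : mean_degree (complete_graph n.+1) = n%:R.
Proof.
have og : order_graph (complete_graph n.+1) = n.+1.
  by rewrite /order_graph card_ord.
rewrite /mean_degree -sum_degree og.
rewrite (eq_bigr (fun=> n)) => [|i _]; last first.
  rewrite (degree_multipartite _ (@complete_multipartite _)) og /=.
  rewrite (eq_card (B := pred1 i)) ?card1 ?subn1 // => j.
  by rewrite !inE.
by rewrite sum_nat_const card_ord natrM mulrAC divff ?mul1r // pnatr_eq0.
Qed.

Lemma energy_complete n : energy (complete_graph n.+1) = (2 * n)%:R.
Proof.
rewrite /energy adjacency_mxE (perm_big _ (spectrum_complete n 0 1)) /=.
rewrite big_cons big_nseq iter_addr_0 mul0r sub0r normrN normr1 add0r mul1r.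
by rewrite normr_nat natrM; ring.
Qed.

Lemma laplacian_energy_complete n :
  laplacian_energy (complete_graph n.+1) = (2 * n)%:R.
Proof.
rewrite /laplacian_energy laplacian_mxE mean_degree_complete.
rewrite (perm_big _ (spectrum_complete n 1 (-1))) /=.
rewrite big_cons big_nseq iter_addr_0 subrr mul0r sub0r normrN normr_nat.
have -> : 1 * n%:R - -1 - n%:R = 1 :> algC by ring.
by rewrite normr1 natrM; ring.
Qed.

Lemma signless_laplacian_energy_complete n :
  signless_laplacian_energy (complete_graph n.+1) = (2 * n)%:R.
Proof.
rewrite /signless_laplacian_energy signless_laplacian_mxE mean_degree_complete.
rewrite (perm_big _ (spectrum_complete n 1 1)) /=.
rewrite big_cons big_nseq iter_addr_0.
have -> : (1 + 1) * n%:R - n%:R = n%:R :> algC by ring.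
have -> : 1 * n%:R - 1 - n%:R = -1 :> algC by ring.
by rewrite normrN normr1 normr_nat natrM; ring.
Qed.

(** All spectra here are real, so the sums are moved to the real closed field [algR], where the
    order is total and real arithmetic is available. *)
Lemma sum_norm_spectrum n (A : 'M[algC]_n) (s : seq algR) (mu : algR) :
  perm_eq (spectrum A) (map algRval s) ->
  \sum_(x <- spectrum A) `|x - algRval mu| = algRval (\sum_(x <- s) `|x - mu|).
Proof. by move=> sE; rewrite (perm_big _ sE) big_map rmorph_sum. Qed.

Lemma map_Sz2_spectrum (R S : pzRingType) (f : {rmorphism R -> S}) z a c r1 r2 :
  map f (Sz2_spectrum z a c r1 r2)
  = Sz2_spectrum z (f a) (f c) (f r1) (f r2).
Proof.
by rewrite /Sz2_spectrum !map_cat !map_nseq !(rmorphM, rmorphB) !rmorph_nat.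
Qed.

Lemma sum_Sz2_spectrum (R : comPzRingType) (F : R -> R) z a c r1 r2 :
  (0 < z)%N ->
  \sum_(x <- Sz2_spectrum z a c r1 r2) F x
  = F r1 + F r2 + 4 * F ((16 * a - 3 * c) * z%:R)
    + (4 * z%:R - 1) * F (15 * a * z%:R)
    + (15 * z%:R - 5) * F (16 * a * z%:R).
Proof.
move=> z0; have [z4 z3] : (0 < 4 * z)%N /\ (0 < 3 * z)%N by lia.
have n4 : (4 * z).-1%:R = 4 * z%:R - 1 :> R by rewrite -subn1 natrB ?natrM.
have n3 : (5 * (3 * z).-1)%:R = 15 * z%:R - 5 :> R.
  by rewrite -subn1 natrM natrB ?natrM //; ring.
rewrite /Sz2_spectrum !big_cat !big_nseq !iter_addr_0 big_cons big_seq1 /=.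
by rewrite -n4 -n3 !mulr_natl !addrA.
Qed.

(** * Sums of absolute deviations over the three spectra *)

Section RealSums.
Variables (R : rcfType) (z : nat).
Hypothesis z0 : (0 < z)%N.
Let u : R := z%:R.
Let u1 : 1 <= u. Proof. by rewrite ler1n. Qed.

Lemma sum_adjacency_spectrum :
  \sum_(x <- Sz2_spectrum z 0 1 ((6 + 4 * Num.sqrt 6) * u)
                                ((6 - 4 * Num.sqrt 6) * u)) `|x - 0|
  = (12 + 8 * Num.sqrt 6) * u.
Proof.
have s2 : Num.sqrt 6 ^+ 2 = 6 :> R by rewrite sqr_sqrtr // ler0n.
have s0 : 0 <= Num.sqrt 6 :> R by rewrite sqrtr_ge0.
rewrite (sum_Sz2_spectrum (fun x => `|x - 0|)) // -/u; move: s2 s0 u1.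
set s := Num.sqrt 6 => s2 s0 u1'.
(* This makes 6 - 4s negative. *)
have sg2 : 2 <= s by nra.
rewrite !subr0 ger0_norm; last by nra.
rewrite ler0_norm; last by nra.
rewrite ler0_norm; last by lra.
rewrite !mulr0 !mul0r normr0; ring.
Qed.

(** The mean degree 300u/19 lies strictly between 15u and 16u, which decides the sign of every
    term. *)
Lemma sum_laplacian_spectrum :
  \sum_(x <- Sz2_spectrum z 1 (-1) (19 * u) 0) `|x - 300 * u / 19|
  = 30 * u + 120 / 19 * u ^+ 2.
Proof.
rewrite (sum_Sz2_spectrum (fun x => `|x - 300 * u / 19|)) // -/u.
move: u1 => u1'.
rewrite ger0_norm; last by lra.
rewrite ler0_norm; last by lra.
rewrite ger0_norm; last by lra.
rewrite ler0_norm; last by lra.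
rewrite ger0_norm; last by lra.
by field.
Qed.

Lemma sum_signless_laplacian_spectrum :
  \sum_(x <- Sz2_spectrum z 1 1 ((43 + Num.sqrt 409) / 2 * u)
                                ((43 - Num.sqrt 409) / 2 * u))
     `|x - 300 * u / 19|
  = (177 / 19 + Num.sqrt 409) * u + 120 / 19 * u ^+ 2.
Proof.
have s2 : Num.sqrt 409 ^+ 2 = 409 :> R by rewrite sqr_sqrtr // ler0n.
have s0 : 0 <= Num.sqrt 409 :> R by rewrite sqrtr_ge0.
rewrite (sum_Sz2_spectrum (fun x => `|x - 300 * u / 19|)) // -/u.
move: s2 s0 u1; set s := Num.sqrt 409 => s2 s0 u1'.
(* This places the two irrational eigenvalues on opposite sides of the mean degree. *)
have sg20 : 20 <= s by nra.
rewrite ger0_norm; last by nra.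
rewrite ler0_norm; last by nra.
rewrite ler0_norm; last by lra.
rewrite ler0_norm; last by lra.
rewrite ger0_norm; last by lra.
by field.
Qed.

End RealSums.

Lemma embedded_spectrum_Sz2_multipartite (R : comNzRingType)
    (f : {rmorphism R -> algC}) (g : sgraph) z (p : vertex g -> 'I_6)
    (a c r1 r2 : R) :
  (0 < z)%N -> Sz2_multipartite z p ->
  r1 + r2 = (31 * a + 12 * c) * z%:R ->
  r1 * r2 = (240 * a ^+ 2 + 180 * a * c - 60 * c ^+ 2) * z%:R ^+ 2 ->
  perm_eq (spectrum (f a *: degree_mx g + f c *: adjacency_mx g))
    (map f (Sz2_spectrum z a c r1 r2)).
Proof.
move=> z0 pS r_sum r_prod.
rewrite map_Sz2_spectrum; apply: spectrum_Sz2_multipartite pS _ _ => //.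
  by rewrite -rmorphD r_sum; ring.
by rewrite -rmorphM r_prod; ring.
Qed.

Lemma embedded_mean_degree (F : fieldType) (f : {rmorphism F -> algC})
    (g : sgraph) z (p : vertex g -> 'I_6) :
  (0 < z)%N -> Sz2_multipartite z p -> mean_degree g = f (300 * z%:R / 19).
Proof.
move=> z0 pS.
by rewrite (mean_degree_Sz2_multipartite z0 pS) fmorph_div rmorphM !rmorph_nat.
Qed.

(** * Roots of the quadratic factors x^2 - 12x - 60, x^2 - 19x and x^2 - 43x + 360, scaled by [u] *)

Section Roots.
Variables (R : rcfType) (u : R).
Lemma adjacency_roots_sum :
  (6 + 4 * Num.sqrt 6) * u + (6 - 4 * Num.sqrt 6) * u = (31 * 0 + 12 * 1) * u.
Proof. by ring. Qed.

Lemma adjacency_roots_prod :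
  (6 + 4 * Num.sqrt 6) * u * ((6 - 4 * Num.sqrt 6) * u)
  = (240 * 0 ^+ 2 + 180 * 0 * 1 - 60 * 1 ^+ 2) * u ^+ 2.
Proof.
have s2 : Num.sqrt 6 ^+ 2 = 6 :> R by rewrite sqr_sqrtr // ler0n.
by ring: s2.
Qed.

Lemma laplacian_roots_sum : 19 * u + 0 = (31 * 1 + 12 * -1) * u.
Proof. by ring. Qed.

Lemma laplacian_roots_prod :
  19 * u * 0 = (240 * 1 ^+ 2 + 180 * 1 * -1 - 60 * (-1) ^+ 2) * u ^+ 2.
Proof. by ring. Qed.

Lemma signless_laplacian_roots_sum :
  (43 + Num.sqrt 409) / 2 * u + (43 - Num.sqrt 409) / 2 * u
  = (31 * 1 + 12 * 1) * u.
Proof. by field. Qed.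

Lemma signless_laplacian_roots_prod :
  (43 + Num.sqrt 409) / 2 * u * ((43 - Num.sqrt 409) / 2 * u)
  = (240 * 1 ^+ 2 + 180 * 1 * 1 - 60 * 1 ^+ 2) * u ^+ 2.
Proof.
have s2 : Num.sqrt 409 ^+ 2 = 409 :> R by rewrite sqr_sqrtr // ler0n.
by field: s2.
Qed.
End Roots.

Section Sz2Energies.
Variables (g : sgraph) (z : nat) (p : vertex g -> 'I_6).
Hypotheses (z0 : (0 < z)%N) (pS : Sz2_multipartite z p).

Lemma energy_Sz2_multipartite :
  energy g = algRval ((12 + 8 * Num.sqrt 6) * z%:R).
Proof.
have P := embedded_spectrum_Sz2_multipartite algRval z0 pS
  (adjacency_roots_sum (z%:R : algR)) (adjacency_roots_prod (z%:R : algR)).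
rewrite rmorph0 rmorph1 -adjacency_mxE in P.
rewrite -(sum_adjacency_spectrum _ z0) -(sum_norm_spectrum 0 P).
by apply: eq_bigr => x _; rewrite rmorph0 subr0.
Qed.

Lemma laplacian_energy_Sz2_multipartite :
  laplacian_energy g = algRval (30 * z%:R + 120 / 19 * z%:R ^+ 2).
Proof.
have P := embedded_spectrum_Sz2_multipartite algRval z0 pS
  (laplacian_roots_sum (z%:R : algR)) (laplacian_roots_prod (z%:R : algR)).
rewrite rmorphN1 rmorph1 -laplacian_mxE in P.
rewrite -(sum_laplacian_spectrum _ z0) -(sum_norm_spectrum _ P).
by rewrite /laplacian_energy (embedded_mean_degree algRval z0 pS).
Qed.

Lemma signless_laplacian_energy_Sz2_multipartite :
  signless_laplacian_energy g =
    algRval ((177 / 19 + Num.sqrt 409) * z%:R + 120 / 19 * z%:R ^+ 2).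
Proof.
have P := embedded_spectrum_Sz2_multipartite algRval z0 pS
  (signless_laplacian_roots_sum (z%:R : algR))
  (signless_laplacian_roots_prod (z%:R : algR)).
rewrite rmorph1 -signless_laplacian_mxE in P.
rewrite -(sum_signless_laplacian_spectrum _ z0) -(sum_norm_spectrum _ P).
by rewrite /signless_laplacian_energy (embedded_mean_degree algRval z0 pS).
Qed.

End Sz2Energies.

(** * Numerical inequalities between the energy formulas *)

Section EnergyBounds.
Variables (R : rcfType) (u : R).
Hypothesis u1 : 1 <= u.

Lemma sqrt6_bounds : 2 <= Num.sqrt 6 :> R /\ Num.sqrt 6 <= 5 / 2 :> R.
Proof.
have s2 : Num.sqrt 6 ^+ 2 = 6 :> R by rewrite sqr_sqrtr // ler0n.
by have s0 : 0 <= Num.sqrt 6 :> R by [rewrite sqrtr_ge0]; split; nra.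
Qed.

Lemma sqrt409_bounds : 20 <= Num.sqrt 409 :> R /\ Num.sqrt 409 <= 81 / 4 :> R.
Proof.
have s2 : Num.sqrt 409 ^+ 2 = 409 :> R by rewrite sqr_sqrtr // ler0n.
by have s0 : 0 <= Num.sqrt 409 :> R by [rewrite sqrtr_ge0]; split; nra.
Qed.

Lemma energy_lt_signless_bound :
  (12 + 8 * Num.sqrt 6) * u < (177 / 19 + Num.sqrt 409) * u + 120 / 19 * u ^+ 2.
Proof.
have [_] := sqrt6_bounds; have [+ _] := sqrt409_bounds; move: u1.
by move: (Num.sqrt 6) (Num.sqrt 409) => s t *; nra.
Qed.

Lemma signless_lt_laplacian_bound :
  (177 / 19 + Num.sqrt 409) * u + 120 / 19 * u ^+ 2
  < 30 * u + 120 / 19 * u ^+ 2.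
Proof.
have [_] := sqrt409_bounds; move: u1 (Num.sqrt 409) => u1' t t1.
by rewrite ltrD2r; nra.
Qed.

Lemma energy_ge_order_bound : 19 * u <= (12 + 8 * Num.sqrt 6) * u.
Proof.
by have [+ _] := sqrt6_bounds; move: u1 (Num.sqrt 6) => u1' s s1; nra.
Qed.

Lemma energy_le_complete_bound : (12 + 8 * Num.sqrt 6) * u <= 38 * u - 2.
Proof.
by have [_] := sqrt6_bounds; move: u1 (Num.sqrt 6) => u1' s s1; nra.
Qed.

(** The difference of the two sides is a quadratic with both roots below 1; at [u = 1] it is only
    6/19. *)
Lemma laplacian_gt_complete_bound : 38 * u - 2 < 30 * u + 120 / 19 * u ^+ 2.
Proof. by move: u1 => u1'; nra. Qed.

Lemma signless_gt_complete_bound : 2 <= u ->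
  38 * u - 2 < (177 / 19 + Num.sqrt 409) * u + 120 / 19 * u ^+ 2.
Proof.
by move=> u2; have [+ _] := sqrt409_bounds; move: (Num.sqrt 409) => t t1; nra.
Qed.

(** This is the case of a trivial center, where 36 = 2 (19 - 1); the left side is about 35.85. *)
Lemma signless_le_complete_bound1 :
  (177 / 19 + Num.sqrt 409) * 1 + 120 / 19 * 1 ^+ 2 <= 36 :> R.
Proof. by have [_] := sqrt409_bounds; move: (Num.sqrt 409) => t t1; lra. Qed.

End EnergyBounds.

(** * Energy comparisons for the graphs with these part sizes *)

Section Comparisons.
Variables (g : sgraph) (z : nat) (p : vertex g -> 'I_6).
Hypotheses (z0 : (0 < z)%N) (pS : Sz2_multipartite z p).
Let u1 : 1 <= z%:R :> algR. Proof. by rewrite ler1n. Qed.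

Lemma order_Sz2_multipartite_pred : order_graph g = (19 * z).-1.+1.
Proof. by rewrite (order_Sz2_multipartite pS) prednK // muln_gt0. Qed.

Lemma complete_energy_algR :
  (2 * (19 * z).-1)%:R = algRval (38 * z%:R - 2).
Proof.
rewrite rmorphB rmorphM !rmorph_nat -natrM -natrB; last by lia.
by congr _%:R; lia.
Qed.

Lemma energy_comparisons :
  energy g < signless_laplacian_energy g
  /\ signless_laplacian_energy g < laplacian_energy g.
Proof.
rewrite (energy_Sz2_multipartite z0 pS).
rewrite (signless_laplacian_energy_Sz2_multipartite z0 pS).
rewrite (laplacian_energy_Sz2_multipartite z0 pS).
split; first exact: (energy_lt_signless_bound u1).
exact: (signless_lt_laplacian_bound u1).
Qed.

Lemma not_hypoenergetic_Sz2_multipartite : ~~ hypoenergetic g.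
Proof.
rewrite /hypoenergetic (energy_Sz2_multipartite z0 pS).
rewrite (order_Sz2_multipartite pS) -(rmorph_nat algRval).
(* The order of [algR] is by definition that of [algC] through [algRval]; the change of type gives
   access to totality, which negating [<] requires. *)
rewrite -[_ < _]/(_ < (19 * z)%:R :> algR) -leNgt natrM.
exact: energy_ge_order_bound.
Qed.

Lemma not_hyperenergetic_Sz2_multipartite : ~~ hyperenergetic g.
Proof.
rewrite /hyperenergetic order_Sz2_multipartite_pred energy_complete.
rewrite complete_energy_algR (energy_Sz2_multipartite z0 pS).
rewrite -[_ < _]/(38 * z%:R - 2 < _ :> algR).
by rewrite -leNgt energy_le_complete_bound.
Qed.

Lemma L_hyperenergetic_Sz2_multipartite : L_hyperenergetic g.
Proof.
rewrite /L_hyperenergetic order_Sz2_multipartite_pred.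
rewrite laplacian_energy_complete complete_energy_algR.
rewrite (laplacian_energy_Sz2_multipartite z0 pS).
exact: (laplacian_gt_complete_bound u1).
Qed.

Lemma Q_hyperenergetic_Sz2_multipartite : Q_hyperenergetic g = (1 < z)%N.
Proof.
rewrite /Q_hyperenergetic order_Sz2_multipartite_pred.
rewrite signless_laplacian_energy_complete.
rewrite complete_energy_algR (signless_laplacian_energy_Sz2_multipartite z0 pS).
rewrite -[_ < _]/(38 * z%:R - 2 < _ :> algR).
have [z2|z1] := ltnP 1 z.
  by rewrite signless_gt_complete_bound ?ler_nat.
have -> : z = 1%N by lia.
apply/negbTE; rewrite -leNgt (le_trans (signless_le_complete_bound1 _)) //.
by rewrite mulr1 -natrB.
Qed.
End Comparisons.

(** * The Suzuki group of order 20 *)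

Section SuzukiGroup.
Local Open Scope group_scope.

(** Any two groups with the presentation are homomorphic images of each other, so [H] has the order
    of the model. *)
Lemma card_Sz2 (gT : finGroupType) (H : {group gT}) : is_Sz2 H -> #|H| = 20%N.
Proof.
move=> hH; have [hM cardM] := is_Sz2_model.
apply: (etrans _ cardM); apply/eqP; rewrite eqn_leq !leq_homg //.
  by rewrite (hM _ H) isoGrp_hom.
by rewrite (hH _ _) isoGrp_hom.
Qed.

Lemma Sz2_Frobenius (gT : finGroupType) (H : {group gT}) : is_Sz2 H ->
  exists a b, [/\ #[a] = 5%N, #[b] = 4%N & [Frobenius H = <[a]> ><| <[b]>]].
Proof.
move=> hH; have cardH := card_Sz2 hH.
have /existsP[[a b] /= /eqP[defH a5 b4 ab]] := isoGrp_hom hH.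
exists a, b.
have nab : <[b]> \subset 'N(<[a]>).
  by rewrite cycle_subG inE -cycleJ ab cycle_subG mem_cycle.
rewrite norm_joinEr // in defH.
have oa : (#[a] %| 5)%N by rewrite order_dvdn a5.
have ob : (#[b] %| 4)%N by rewrite order_dvdn b4.
(* The product of the orders of [a] and [b] is at least 20, while they are at most 5 and 4, so both
   bounds are attained. *)
have := mul_cardG <[a]> <[b]>; rewrite defH cardH -!orderE => mc.
have la : (#[a] <= 5)%N by apply: dvdn_leq oa.
have lb : (#[b] <= 4)%N by apply: dvdn_leq ob.
have I0 := cardG_gt0 (<[a]> :&: <[b]>).
have ea : #[a] = 5%N by nia.
have eb : #[b] = 4%N by nia.
have tab : <[a]> :&: <[b]> = 1.
  by apply: coprime_TIg; rewrite -!orderE ea eb.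
split=> //; apply/Frobenius_semiregularP; first by rewrite sdprodE.
- by rewrite -cardG_gt1 -orderE ea.
- by rewrite -cardG_gt1 -orderE eb.
move=> x /setD1P[ntx /cyclePmin[i]]; rewrite eb => i4 def_x.
apply: prime_TIg; first by rewrite -orderE ea.
rewrite cycle_subG; apply: contra ntx => /cent1P cax.
(* If [b ^+ i] centralizes [a], then 2^i = 1 modulo 5; as 2 has order 4 modulo 5, this forces
   [i = 0] for [i < 4]. *)
have abi n : a ^ (b ^+ n) = a ^+ (2 ^ n)%N.
  elim: n => [|n IHn]; first by rewrite conjg1.
  by rewrite expgSr conjgM IHn conjXg ab -expgM expnS.
have := abi i; rewrite -def_x /conjg cax mulKg => /eqP.
rewrite -{1}(expg1 a) eq_expg_mod_order ea def_x.
by case: i i4 {def_x} => [|[|[|[|]]]].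
Qed.

(** Index 0 is the Frobenius kernel, the others are the conjugates of the complement. Cyclicity is
    recorded because it makes the preimages in a central extension abelian. *)
Lemma Sz2_cyclic_partition (gT : finGroupType) (H : {group gT}) : is_Sz2 H ->
  exists C : 'I_6 -> {group gT},
  [/\ forall k, C k \subset H /\ cyclic (C k),
      forall k, #|C k| = if k == 0%R then 5%N else 4%N,
      forall x, x \in H -> exists k, x \in C k,
      forall k l x, x \in (C k)^# -> x \in C l -> k = l
    & forall k x, x \in (C k)^# -> 'C_H[x] \subset C k].
Proof.
move=> hH; have [a [b [oa ob frobH]]] := Sz2_Frobenius hH.
have [/sdprodP[_ defH nab tab] _ _ _ _] := Frobenius_context frobH.
have [sKH sBH] := mulG_sub defH.
have aH i : a ^+ i \in H by rewrite (subsetP sKH) ?mem_cycle.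
have compl := FrobeniusWcompl frobH.
have /andP[_ tiB] := compl.
(* As a ^+ 5 = 1, the indices 1, .., 5 of the complements cover all of <[a]>. *)
pose C (k : 'I_6) := if k == 0%R then <[a]>%G else (<[b]> :^ (a ^+ k))%G.
exists C; split.
- move=> k; rewrite /C; case: ifP => _; first by rewrite cycle_cyclic.
  by rewrite cyclicJ cycle_cyclic -{1}(conjGid (aH k)) conjSg.
- by move=> k; rewrite /C; case: ifP; rewrite /= ?cardJg -orderE ?oa ?ob.
- move=> x Hx; have /and3P[/eqP covH _ _] := Frobenius_partition frobH.
  move: Hx; rewrite -covH => /bigcupP[B]; rewrite !inE => /orP[/eqP-> Kx|].
    by exists 0%R.
  move=> /imsetP[y Ky ->] Bx.
  have {Ky}[i i5 def_y] : exists2 i : 'I_6, i != 0%R & y = a ^+ i.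
    have [[|m] lt_m ->] := cyclePmin Ky; rewrite oa in lt_m.
      by exists (inord 5); rewrite -?val_eqE /= ?inordK // -oa expg_order expg0.
    by exists (inord m.+1); rewrite -?val_eqE /= ?inordK // ltnW.
  exists i; rewrite /C (negPf i5) -def_y.
  by apply: subsetP Bx; rewrite conjSg subsetDl.
- have mem_conj_compl i (x : gT) : x \in (<[b]> :^ (a ^+ i))^# ->
      x ^ (a ^- i) \in <[b]>^#.
    by rewrite -mem_conjg conjD1g.
  (* Conjugating back by [a ^- i] keeps [x] in the kernel and brings it into [<[b]>]. *)
  have KB x i : x \in <[a]> -> x \in <[b]> :^ (a ^+ i) -> x = 1.
    rewrite mem_conjg => Kx Bx; apply/eqP; rewrite -(conjg_eq1 x (a ^- i)).
    rewrite -in_set1 -[[set 1]]/(1%g : {set gT}) -tab inE Bx andbT.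
    by rewrite groupJ // groupV mem_cycle.
  move=> k l x; rewrite /C.
  case: eqP => [->|/eqP k0]; case: eqP => [->|/eqP l0] //.
  + by move=> /setD1P[nt Kx] /(KB _ _ Kx)/eqP; rewrite (negPf nt).
  + by move=> /setD1P[nt Bx] Kx; move/eqP: (KB _ _ Kx Bx); rewrite (negPf nt).
  move=> xk xl; have [ntx _] := setD1P xk; apply/val_inj.
  have xl1 : x \in (<[b]> :^ (a ^+ l))^# by rewrite !inE ntx.
  have [_ _ tiJ] := normedTI_memJ_P tiB.
  (* This element conjugates one nontrivial element of [<[b]>] to another, hence lies in [<[b]>] by
     the trivial intersection property. It also lies in [<[a]>], so it is 1, and [k = l] since both
     lie between 1 and 5. *)
  have Bg : a ^+ k * a ^- l \in <[b]>.
    rewrite -(tiJ _ _ (mem_conj_compl _ _ xk)) ?groupM ?groupV ?aH //.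
    by rewrite -conjgM mulKg mem_conj_compl.
  have : a ^+ k * a ^- l \in <[a]> :&: <[b]>.
    by rewrite inE Bg andbT groupM ?groupV ?mem_cycle.
  rewrite tab inE -eq_mulgV1 eq_expg_mod_order oa.
  by case: k l k0 l0 {xk xl xl1 Bg}
    => [[|[|[|[|[|[|?]]]]]] ?] [[|[|[|[|[|[|?]]]]]] ?].
- move=> k x; rewrite /C; case: ifP => _ xC.
    exact: (Frobenius_cent1_ker frobH).
  apply: (cent1_normedTI (A := (<[b]> :^ (a ^+ k))^#)) => //.
  by rewrite -conjD1g -{1}(conjGid (aH k)) normedTI_J.
Qed.

(** The centralizer of a nontrivial element lies in some [C k], of order at most 5, so it is not the
    whole group. *)
Lemma center_Sz2 (gT : finGroupType) (H : {group gT}) : is_Sz2 H -> 'Z(H) = 1.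
Proof.
move=> hH; have [C [_ cardC covC _ centC]] := Sz2_cyclic_partition hH.
apply/trivgP/subsetP => x /setIP[Hx cHx]; rewrite inE; apply/idPn => ntx.
have [k Ckx] := covC x Hx.
have /subset_leq_card : 'C_H[x] \subset C k by rewrite centC // !inE ntx.
rewrite cardC (setIidPl _) ?(card_Sz2 hH); first by case: ifP.
by apply/subsetP => y Hy; apply/cent1P; exact/commute_sym/(centP cHx).
Qed.

(** Two elements in the same preimage [M k] commute because [M k] is abelian. Conversely, commuting
    elements have commuting images, and the centralizer condition puts these in the same [C k]. *)
Lemma noncommuting_graph_Sz2_multipartite (gT : finGroupType) (G : {group gT}) :
  is_Sz2 (G / 'Z(G)) ->
  exists p : vertex (noncommuting_graph G) -> 'I_6, Sz2_multipartite #|'Z(G)| p.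
Proof.
move=> hH; have [C [subC cardC covC injC centC]] := Sz2_cyclic_partition hH.
set Z := 'Z(G)%G; have nZ : G \subset 'N(Z) := normal_norm (center_normal G).
have nZx x : x \in G -> x \in 'N(Z) := subsetP nZ x.
pose M k := (coset Z @*^-1 (C k))%G.
(* The default value is never taken: the [C k] cover the quotient, so each vertex lies in some
   [M k], and by [pP] in only one. *)
pose p (x : vertex (noncommuting_graph G)) : 'I_6 :=
  odflt 0%R [pick k | val x \in M k].
have subM k : M k \subset G.
  by rewrite sub_cosetpre_quo ?center_normal // (subC k).1.
have ZM k : Z \subset M k by apply: sub_cosetpre.
have abM k : abelian (M k).
  apply: (@cyclic_factor_abelian _ Z); last by rewrite cosetpreK (subC k).2.
  by rewrite subsetI ZM (subset_trans (subsetIr G 'C(G))) // centS.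
have memM k x : x \in G -> (x \in M k) = (coset Z x \in C k).
  by move=> Gx; rewrite /= morphpreE inE nZx //= inE.
have ntC k x : x \in G :\: Z -> x \in M k -> coset Z x \in (C k)^#.
  move=> /setDP[Gx nZx']; rewrite memM // => Cx; rewrite !inE Cx andbT.
  by apply: contra nZx' => /eqP/coset_idr; apply; apply: nZx.
have pP (x : vertex (noncommuting_graph G)) k : (val x \in M k) = (p x == k).
  have /setDP[Gx _] := valP x; have Mx l := ntC l _ (valP x).
  rewrite /p; case: pickP => [l Ml|no] /=; last first.
    have [l Cl] := covC _ (mem_quotient Z Gx).
    by have := no l; rewrite memM // Cl.
  apply/idP/eqP => [Mk|<- //]; apply: injC (Mx _ Ml) _.
  by rewrite -memM.
exists p; split=> [x y|k].
  have /setDP[Gx _] := valP x; have /setDP[Gy _] := valP y.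
  rewrite /edge /=; congr negb; apply/eqP/eqP => [cxy|pxy].
    apply/esym/eqP; rewrite -pP memM //.
    apply: (subsetP (centC _ (coset Z (val x)) _)).
      by apply: ntC (valP x) _; rewrite pP.
    rewrite inE mem_quotient //=; apply/cent1P.
    by rewrite /commute -!morphM ?nZx //= cxy.
  have Mx : val x \in M (p y) by rewrite pP pxy.
  have My : val y \in M (p y) by rewrite pP.
  exact: (centsP (abM _) _ Mx _ My).
rewrite -(card_imset _ val_inj).
transitivity #|M k :\: Z|.
  apply: eq_card => x; apply/imsetP/setDP => [[y]|[Mx nZx']].
    rewrite inE -pP => My ->; split=> //.
    by have /setDP[] := valP y.
  have Gx : x \in G :\: Z by rewrite inE nZx' (subsetP (subM k)).
  by exists (Sub x Gx) => //; rewrite inE -pP.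
rewrite cardsDS // card_cosetpre cardC /Sz2_part_size -[X in (_ - X)%N]muln1.
by rewrite -mulnBr mulnC; case: ifP.
Qed.

End SuzukiGroup.

Theorem theorem4p3 (sT : finGroupType) (Sz2 : {group sT}) (hS : is_Sz2 Sz2)
    (gT : finGroupType) (G : {group gT})
    (hG : (G / 'Z(G))%g \isog Sz2) :
  [/\ (* (a) *)
      energy (noncommuting_graph G)
          < signless_laplacian_energy (noncommuting_graph G)
        /\ signless_laplacian_energy (noncommuting_graph G)
          < laplacian_energy (noncommuting_graph G),
      (* (b) *)
      ~~ hypoenergetic (noncommuting_graph G)
        /\ ~~ hyperenergetic (noncommuting_graph G)
    & (* (c) *)
      (~~ Q_hyperenergetic (noncommuting_graph Sz2)
         /\ L_hyperenergetic (noncommuting_graph Sz2))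
      /\ (~~ (G \isog Sz2) ->
          Q_hyperenergetic (noncommuting_graph G)
          /\ L_hyperenergetic (noncommuting_graph G))].
Proof.
have [p pG] := noncommuting_graph_Sz2_multipartite (isoGrp_trans hG hS).
have ZS : 'Z(Sz2) = 1%g := center_Sz2 hS.
(* The center being trivial, [Sz2] itself satisfies the hypothesis on [G], with [z = 1]. *)
have isoS : Sz2 / 'Z(Sz2) \isog Sz2.
  by rewrite ZS isog_sym quotient1_isog.
have [q qS] := noncommuting_graph_Sz2_multipartite (isoGrp_trans isoS hS).
have zG : (0 < #|'Z(G)|)%N := cardG_gt0 _.
have zS : (0 < #|'Z(Sz2)|)%N := cardG_gt0 _.
split; first exact: energy_comparisons pG.
  split; first exact: not_hypoenergetic_Sz2_multipartite pG.
  exact: not_hyperenergetic_Sz2_multipartite pG.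
split; first split.
- by rewrite (Q_hyperenergetic_Sz2_multipartite zS qS) ZS cards1.
- exact: L_hyperenergetic_Sz2_multipartite qS.
move=> niso; split; last exact: L_hyperenergetic_Sz2_multipartite pG.
rewrite (Q_hyperenergetic_Sz2_multipartite zG pG) cardG_gt1.
(* A trivial center would make [G] isomorphic to its central quotient, hence to [Sz2]. *)
apply: contra niso => /eqP ZG; rewrite ZG in hG.
exact: isog_trans (quotient1_isog G) hG.
Qed.
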